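(* Let $X$ be a random variable with values in $I^n$ having a continuous density, and assume the decision boundaries $\{x\in I^n:\kappa(x)=0\}$ have Lebesgue measure zero. Let $X_k$ be the $k$-th iterate lying inside the feasible set $\mathcal{F}$ of the primary CW attack started at $X$, and take as underlying probability measure $P$ the conditional probability given that the primary attack is successful, so that almost surely $X_k\to X^*\in\partial\mathcal{F}$ as $k\to\infty$, where $X^*$ is a stationary point of the primary objective and $X^*\in(0,1)^n$. Assume that the penalties have no zero gradients inside the polytopes, that there are no polytope boundaries at (i.e. no polytope facets contained in) decision boundaries, and that almost surely $\kappa(X_k)\ne0$ for all $k$. For each $k$ let $X_{k,j}$, $j=0,1,\dots$, be the iterates of the CW counter attack started at $X_{k,0}=X_k$, with step-size schedule $(\alpha_{k,j})_j$ and penalty parameter $b_k$, and let $X_{k,j^*}$ be the first iterate of the counter attack lying in the counter attack's feasible set $\mathcal{F}^{(2)}$ (assumed to exist almost surely). Let $$D^{(0,k)}=\|X-X_k\|_2,\qquad \bar D^{(k,j^* )}=\|X_k-X_{k,j^*}\|_2 .$$ Then, if the penalty parameters $b_k$ are sufficiently large and the initial step sizes $\alpha_{k,0}$ are sufficiently small (with thresholds for $b_k$ that may depend on $k$ and on the realization, and thresholds for $\alpha_{k,0}$ that may depend on $k$, on the realization and on $b_k$), the distribution of the counter attack distance is asymptotically perfectly separated from the distribution of the primary attack distance: $$\mathrm{AUROC}\bigl(\bar D^{(k,j^* )},D^{(0,k)}\bigr)\longrightarrow1\qquad(k\to\infty).$$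
   Context: $I=[0,1]$, $n\ge1$, $c\ge2$. A ReLU network gives a continuous map $Z=(Z_1,\dots,Z_c):I^n\to\mathbb{R}^c$ (logits); $I^n$ is the union of finitely many closed convex polytopes, on each of which $Z$ is affine. The class map is $\kappa(x)=i$ if $Z_i(x)>Z_j(x)$ for all $j\ne i$, and $\kappa(x)=0$ if no such $i$ exists. Primary attack on $x_0$ with $t=\kappa(x_0)\ne0$: $f(x)=\max\{Z_t(x)-\max_{i\ne t}Z_i(x),0\}$, $F(x)=\|x-x_0\|_2^2+af(x)$ with $a>0$ large, $\mathcal{F}=\{x\in I^n:\kappa(x)\ne t\}$, $\mathcal{NF}=\{x\in I^n:\kappa(x)=t\}$, and $\partial\mathcal{F}$ is the boundary between them. Iteration: $x_{k+1}=P(x_k-\alpha_kG_k)$, $G_k\in\nabla_CF(x_k)$, started at $x_0$, with an admissible step-size schedule. Here $P(\cdot)$ is the orthogonal projection onto $I^n$; $\nabla_Cg(x)=\mathrm{conv}\{\lim_i\nabla g(x_i):x_i\to x,\ \nabla g(x_i)\text{ exists}\}$; a schedule is admissible if it is positive, non-increasing, tends to $0$, has infinite sum and finite sum of squares. The attack is successful if the iteration converges to a point outside $\mathcal{NF}$ and has iterates in $\mathcal{F}$ arbitrarily late, so that ''the $k$-th iterate inside $\mathcal F$'' is defined for all $k$. A point $x\in I^n$ is stationary for $F$ if $0\in\nabla_CF(x)+N_{I^n}(x)$, where $N_{I^n}(x)=\{z:z^T(z'-x)\le0\ \forall z'\in I^n\}$. Counter attack started at $x_k$ with $t_2=\kappa(x_k)\ne0$: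 $f^{(2)}(x)=\max\{Z_{t_2}(x)-\max_{i\ne t_2}Z_i(x),0\}$, $F^{(2)}(x)=\|x-x_k\|_2^2+b f^{(2)}(x)$, feasible set $\mathcal{F}^{(2)}=\{x\in I^n:\kappa(x)\ne t_2\}$, infeasible set $\mathcal{NF}^{(2)}=\{x\in I^n:\kappa(x)=t_2\}$; the iteration is $y_0=x_k$, $y_{j+1}=P(y_j-\alpha_jG_j)$ with $G_j\in\nabla_CF^{(2)}(y_j)$ and an admissible schedule, stopped at the first iterate in $\mathcal{F}^{(2)}$. ''No zero gradients inside the polytopes'' means: at every point of the interior of a polytope that lies in the respective infeasible region and at which the respective penalty ($f$ or $f^{(2)}$) is differentiable, its gradient is nonzero. All of $X_k$, $X^*$, $X_{k,j^*}$ are assumed to be random variables (measurable). For a real random variable $D$, $F_D(\tau)=P(D\le\tau)$ and $D_*P$ is its law. For nonnegative real random variables $D,D'$, $\mathrm{AUROC}(D,D')=\int_{[0,\infty)}F_D(\tau)\,d(D'_*P)(\tau)$. *)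

(* Defs.v *)
From HB Require Import structures.
From mathcomp Require Export all_boot all_order all_algebra.
From mathcomp Require Export all_classical all_reals all_analysis.

Set Implicit Arguments.
Unset Strict Implicit.
Unset Printing Implicit Defensive.

Export Order.TTheory GRing.Theory Num.Theory.
Export numFieldNormedType.Exports.

Local Open Scope classical_set_scope.
Local Open Scope ring_scope.

(* The library norm on 'rV is the sup norm, hence the explicit Euclidean one. *)
Definition dotv (R : realType) (n : nat) (u v : 'rV[R]_n) : R :=
  \sum_i u ord0 i * v ord0 i.

Definition enorm (R : realType) (n : nat) (u : 'rV[R]_n) : R :=
  Num.sqrt (dotv u u).

Definition cube (R : realType) (n : nat) : set 'rV[R]_n :=
  [set x | forall i, 0 <= x ord0 i <= 1].
Arguments cube {R n}.

Definition polytope (R : realType) (n : nat) (Q : set 'rV[R]_n) : Prop :=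
  bounded_set Q /\
  exists (m : nat) (A : 'M[R]_(n, m)) (b : 'rV[R]_m),
    Q = [set x | forall j, (x *m A) ord0 j <= b ord0 j].

Definition face (R : realType) (n : nat) (Q F : set 'rV[R]_n) : Prop :=
  exists (l : 'rV[R]_n) (beta : R),
    (forall x, Q x -> dotv l x <= beta) /\
    F = Q `&` [set x | dotv l x = beta].

(* Facets are the maximal proper faces; the empty face is excluded so that a
   one-point polytope has no facet. *)
Definition facet (R : realType) (n : nat) (Q F : set 'rV[R]_n) : Prop :=
  [/\ face Q F, F !=set0, F <> Q &
      forall F', face Q F' -> F' <> Q -> F `<=` F' -> F' = F].

(* The map computed by a ReLU network on the cube, together with the polytopes
   on which it is affine.  Only the values of Z on the cube are ever used. *)
Definition relu_logits (R : realType) (n c N : nat)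
    (Z : 'rV[R]_n -> 'rV[R]_c) (Q : 'I_N -> set 'rV[R]_n) : Prop :=
  [/\ {within cube, continuous Z},
      forall i, polytope (Q i),
      \bigcup_i Q i = cube &
      forall i, exists (W : 'M[R]_(n, c)) (b : 'rV[R]_c),
        forall x, Q i x -> Z x = x *m W + b].

(* None encodes the value 0 (no class). *)
Definition kappa (R : realType) (n c : nat) (Z : 'rV[R]_n -> 'rV[R]_c)
    (x : 'rV[R]_n) : option 'I_c :=
  [pick i | [forall j, (j != i) ==> (Z x ord0 j < Z x ord0 i)]].

Definition decision_boundary (R : realType) (n c : nat)
    (Z : 'rV[R]_n -> 'rV[R]_c) : set 'rV[R]_n :=
  [set x | cube x /\ kappa Z x = None].

Definition feasible (R : realType) (n c : nat) (Z : 'rV[R]_n -> 'rV[R]_c)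
    (t : 'I_c) : set 'rV[R]_n :=
  [set x | cube x /\ kappa Z x <> Some t].

Definition infeasible (R : realType) (n c : nat) (Z : 'rV[R]_n -> 'rV[R]_c)
    (t : 'I_c) : set 'rV[R]_n :=
  [set x | cube x /\ kappa Z x = Some t].

Definition feasible_boundary (R : realType) (n c : nat)
    (Z : 'rV[R]_n -> 'rV[R]_c) (t : 'I_c) : set 'rV[R]_n :=
  closure (feasible Z t) `&` closure (infeasible Z t).

(* The supremum is a maximum over a finite set, nonempty as soon as c >= 2. *)
Definition penalty (R : realType) (n c : nat) (Z : 'rV[R]_n -> 'rV[R]_c)
    (t : 'I_c) (x : 'rV[R]_n) : R :=
  Num.max (Z x ord0 t - sup [set Z x ord0 i | i in [set~ t]]) 0.

Definition objective (R : realType) (n c : nat) (Z : 'rV[R]_n -> 'rV[R]_c)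
    (t : 'I_c) (lam : R) (x0 x : 'rV[R]_n) : R :=
  enorm (x - x0) ^+ 2 + lam * penalty Z t x.

(* Only meaningful at points where g is differentiable. *)
Definition grad (R : realType) (n : nat) (g : 'rV[R]_n -> R) (x : 'rV[R]_n) :
    'rV[R]_n :=
  \row_i 'D_(delta_mx ord0 i) g x.

Definition convex_hull (R : realType) (n : nat) (A : set 'rV[R]_n) :
    set 'rV[R]_n :=
  [set v | exists (m : nat) (w : 'I_m -> R) (u : 'I_m -> 'rV[R]_n),
     [/\ forall i, 0 <= w i, \sum_i w i = 1, forall i, A (u i) &
         v = \sum_i w i *: u i]].

(* The functions to which this is applied live on the cube: gradients are taken
   at interior points of the cube, so that values outside the cube are
   irrelevant. *)
Definition clarke (R : realType) (n : nat) (g : 'rV[R]_n -> R)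
    (x : 'rV[R]_n) : set 'rV[R]_n :=
  convex_hull [set v | exists u : nat -> 'rV[R]_n,
    [/\ forall i, interior cube (u i) /\ differentiable g (u i),
        u i @[i --> \oo] --> x &
        grad g (u i) @[i --> \oo] --> v]].

Definition normal_cone (R : realType) (n : nat) (x : 'rV[R]_n) :
    set 'rV[R]_n :=
  [set z | forall z', cube z' -> dotv z (z' - x) <= 0].

Definition stationary (R : realType) (n : nat) (g : 'rV[R]_n -> R)
    (x : 'rV[R]_n) : Prop :=
  cube x /\ exists v z, [/\ clarke g x v, normal_cone x z & v + z = 0].

Definition no_zero_gradients (R : realType) (n c N : nat)
    (Z : 'rV[R]_n -> 'rV[R]_c) (Q : 'I_N -> set 'rV[R]_n) (t : 'I_c) : Prop :=
  forall i x, interior (Q i) x -> infeasible Z t x ->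
    differentiable (penalty Z t) x -> grad (penalty Z t) x <> 0.

Definition orth_proj (R : realType) (n : nat) (y p : 'rV[R]_n) : Prop :=
  cube p /\ forall z, cube z -> enorm (y - p) <= enorm (y - z).

Definition admissible (R : realType) (alpha : nat -> R) : Prop :=
  [/\ forall j, 0 < alpha j,
      forall j, alpha j.+1 <= alpha j,
      alpha j @[j --> \oo] --> 0,
      series alpha j @[j --> \oo] --> +oo &
      cvgn (series (fun j => alpha j ^+ 2))].

Definition attack_step (R : realType) (n : nat) (g : 'rV[R]_n -> R)
    (alpha : nat -> R) (y : nat -> 'rV[R]_n) (j : nat) : Prop :=
  exists2 G, clarke g (y j) G & orth_proj (y j - alpha j *: G) (y j.+1).

Definition primary_attack (R : realType) (n c : nat)
    (Z : 'rV[R]_n -> 'rV[R]_c) (t : 'I_c) (a : R) (alpha : nat -> R)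
    (x0 : 'rV[R]_n) (x : nat -> 'rV[R]_n) : Prop :=
  x 0%N = x0 /\ forall j, attack_step (objective Z t a x0) alpha x j.

Definition counter_attack (R : realType) (n c : nat)
    (Z : 'rV[R]_n -> 'rV[R]_c) (t2 : 'I_c) (b : R) (alpha : nat -> R)
    (xk : 'rV[R]_n) (y : nat -> 'rV[R]_n) (jstar : nat) : Prop :=
  [/\ y 0%N = xk,
      forall j, (j < jstar)%N ->
        attack_step (objective Z t2 b xk) alpha y j /\ ~ feasible Z t2 (y j) &
      feasible Z t2 (y jstar)].

Definition successful (R : realType) (n c : nat) (Z : 'rV[R]_n -> 'rV[R]_c)
    (t : 'I_c) (x : nat -> 'rV[R]_n) : Prop :=
  (exists2 l, x j @[j --> \oo] --> l & ~ infeasible Z t l) /\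
  forall m, exists2 j, (m <= j)%N & feasible Z t (x j).

Definition success_event (R : realType) (n c : nat) (Omega : Type)
    (Z : 'rV[R]_n -> 'rV[R]_c) (X : Omega -> 'rV[R]_n)
    (x : nat -> Omega -> 'rV[R]_n) : set Omega :=
  [set w | exists2 t, kappa Z (X w) = Some t & successful Z t (x ^~ w)].

(* v enumerates, in order, the feasible iterates of x. *)
Definition feasible_iterates (R : realType) (n c : nat)
    (Z : 'rV[R]_n -> 'rV[R]_c) (t : 'I_c) (x v : nat -> 'rV[R]_n) : Prop :=
  exists phi : nat -> nat,
    [/\ forall k, (phi k < phi k.+1)%N,
        forall m, feasible Z t (x m) <-> exists k, phi k = m &
        forall k, v k = x (phi k)].

(* Measurability for the product (i.e. Borel) sigma-algebra of R^n. *)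
Definition random_vector (R : realType) (n : nat) (d : measure_display)
    (Omega : measurableType d) (X : Omega -> 'rV[R]_n) : Prop :=
  forall i, measurable_fun [set: Omega] (fun w => X w ord0 i).

Definition row_of_tuple (R : realType) (n : nat) (t : n.-tuple R) : 'rV[R]_n :=
  \row_i tnth t i.

(* n-fold product of the Lebesgue measure on R. *)
Fixpoint lebesgue_tuple (R : realType) (n : nat) :
    set (n.-tuple R) -> \bar R :=
  match n return set (n.-tuple R) -> \bar R with
  | 0%N => dirac [tuple]
  | m.+1 => pushforward
      (product_measure1 (@lebesgue_measure R) (@lebesgue_tuple R m))
      (fun p : R * m.-tuple R => [tuple of p.1 :: p.2])
  end.
Arguments lebesgue_tuple {R} n.

Definition lebesgue_rV (R : realType) (n : nat) (A : set 'rV[R]_n) : \bar R :=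
  lebesgue_tuple n [set t | A (row_of_tuple t)].

Definition continuous_density (R : realType) (n : nat) (d : measure_display)
    (Omega : measurableType d) (P : probability Omega R)
    (X : Omega -> 'rV[R]_n) : Prop :=
  exists p : 'rV[R]_n -> R,
    [/\ {within cube, continuous p},
        forall x, cube x -> 0 <= p x &
        forall A : set (n.-tuple R), measurable A ->
          P [set w | A [tuple X w ord0 i | i < n]] =
          (\int[lebesgue_tuple n]_(t in A `&` [set t | cube (row_of_tuple t)])
             (p (row_of_tuple t))%:E)%E].

(* P (A `&` S) / P S when P S > 0. *)
Definition cond_prob (R : realType) (d : measure_display)
    (Omega : measurableType d) (P : probability Omega R) (S : set Omega)
    (mS : measurable S) : probability Omega R :=
  mnormalize (mrestr P mS) P.

Definition auroc (R : realType) (d : measure_display)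
    (Omega : measurableType d) (P : probability Omega R) (D D' : Omega -> R) :
    \bar R :=
  (\int[pushforward P D']_(tau in `[0%R, +oo[) P [set w | (D w <= tau)%R])%E.

(* Main.v *)
From HB Require Import structures.
Require Import Defs.
From mathcomp Require Import ring lra measurable_realfun.

(* Fix a realization with X_k -> p = X^* and write t2 for the class of X_k.
   Since p lies in the closure of {kappa = t} and t2 <> t, p is not of class t2.
   Near p every polytope contains p, so along the segment from u to p the
   penalty is a maximum of 0 and a minimum of affine functions, and the one
   active at u is nonpositive at p: the penalty does not increase towards p.
   Hence every Clarke gradient G of the counter objective at y satisfies
   G . (p - y) <= 2 (y - X_k) . (p - y).  With rho > |X_k - p|, a small step
   from y decreases the distance to p when |y - X_k| >= 2 rho, and otherwise
   moves by at most rho; so the counter attack never leaves the ball of radius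
   4 rho around p, whatever b_k and the number of steps.  The counter distance
   therefore tends to 0 almost surely while |X - X_k| tends to |X - p|, which is
   positive because p lies in the closure of {kappa <> t}. *)

Set Implicit Arguments.
Unset Strict Implicit.
Unset Printing Implicit Defensive.

Local Open Scope classical_set_scope.
Local Open Scope ring_scope.

(** * Euclidean geometry *)

Section Euclidean.
Context {R : realType} {n : nat}.
Implicit Types (u v w p q : 'rV[R]_n) (s : R).

Lemma dotvC u v : dotv u v = dotv v u.
Proof. by apply: eq_bigr => i _; rewrite mulrC. Qed.

Lemma dotvDl u v w : dotv (u + v) w = dotv u w + dotv v w.
Proof. by rewrite -big_split; apply: eq_bigr => i _; rewrite !mxE mulrDl. Qed.

Lemma dotvZl s u v : dotv (s *: u) v = s * dotv u v.
Proof. by rewrite mulr_sumr; apply: eq_bigr => i _; rewrite !mxE mulrA. Qed.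

Lemma dotvNl u v : dotv (- u) v = - dotv u v.
Proof. by rewrite -scaleN1r dotvZl mulN1r. Qed.

Lemma dotvDr u v w : dotv w (u + v) = dotv w u + dotv w v.
Proof. by rewrite dotvC dotvDl !(dotvC _ w). Qed.

Lemma dotvZr s u v : dotv v (s *: u) = s * dotv v u.
Proof. by rewrite dotvC dotvZl dotvC. Qed.

Lemma dotvNr u v : dotv v (- u) = - dotv v u.
Proof. by rewrite dotvC dotvNl dotvC. Qed.

Definition dotvE := (dotvDl, dotvDr, dotvNl, dotvNr, dotvZl, dotvZr).

Lemma dotv_ge0 u : 0 <= dotv u u.
Proof. by apply: sumr_ge0 => i _; rewrite -expr2 sqr_ge0. Qed.

Lemma enorm_ge0 u : 0 <= enorm u.
Proof. exact: sqrtr_ge0. Qed.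

Lemma enorm_sqr u : enorm u ^+ 2 = dotv u u.
Proof. by rewrite sqr_sqrtr // dotv_ge0. Qed.

Lemma enorm_coord u i : `|u ord0 i| <= enorm u.
Proof.
rewrite -sqrtr_sqr; apply: ler_wsqrtr; rewrite /dotv (bigD1 i) //= expr2.
by rewrite lerDl; apply: sumr_ge0 => j _; rewrite -expr2 sqr_ge0.
Qed.

Lemma enorm_eq0 u : enorm u = 0 -> u = 0.
Proof.
move=> u0; apply/rowP => i; apply/eqP; rewrite mxE -normr_le0 -u0.
exact: enorm_coord.
Qed.

Lemma enormN u : enorm (- u) = enorm u.
Proof. by rewrite /enorm !dotvE opprK. Qed.

Lemma enorm0 : enorm (0 : 'rV[R]_n) = 0.
Proof. by rewrite /enorm -(scale0r 0) dotvZl mul0r sqrtr0. Qed.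

Lemma enormB u v : enorm (u - v) = enorm (v - u).
Proof. by rewrite -enormN opprB. Qed.

(** Cauchy-Schwarz: the square of [enorm v *: u - enorm u *: v] expands to [2 * (enorm u * enorm v)
    * (enorm u * enorm v - dotv u v)]. *)
Lemma dotv_le_enorm u v : dotv u v <= enorm u * enorm v.
Proof.
have [u0|u0] := eqVneq (enorm u) 0.
  by rewrite (enorm_eq0 u0) -(scale0r 0) dotvZl mul0r mulr_ge0 ?enorm_ge0.
have [v0|v0] := eqVneq (enorm v) 0.
  by rewrite (enorm_eq0 v0) -(scale0r 0) dotvZr mul0r mulr_ge0 ?enorm_ge0.
have up : 0 < enorm u by rewrite lt0r u0 enorm_ge0.
have vp : 0 < enorm v by rewrite lt0r v0 enorm_ge0.
have uv : 0 < enorm u * enorm v by exact: mulr_gt0.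
have := dotv_ge0 (enorm v *: u - enorm u *: v).
rewrite !dotvE -!enorm_sqr (dotvC v u) => h.
have {h}: 0 <= 2 * (enorm u * enorm v) * (enorm u * enorm v - dotv u v) by lra.
by rewrite pmulr_rge0 ?subr_ge0 // mulr_gt0.
Qed.

Lemma enormD u v : enorm (u + v) <= enorm u + enorm v.
Proof.
rewrite -[leRHS]ger0_norm ?addr_ge0 ?enorm_ge0 // -sqrtr_sqr.
apply: ler_wsqrtr; rewrite !dotvE sqrrD !enorm_sqr (dotvC v u).
by have := dotv_le_enorm u v; lra.
Qed.

Lemma enorm_le_sqr u v : dotv u u <= dotv v v -> enorm u <= enorm v.
Proof. exact: ler_wsqrtr. Qed.

Lemma cube_segment p q s : cube p -> cube q -> 0 <= s <= 1 ->
  cube (p + s *: (q - p)).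
Proof.
move=> cp cq /andP[s0 s1] i; rewrite !mxE.
have /andP[p0 p1] := cp i; have /andP[q0 q1] := cq i.
by apply/andP; split; nra.
Qed.

(** Comparing [q] with points of the segment towards [p] gives the obtuse angle condition [c0].
    Expanding [(z - q) - (p - q)] then gives the bound. *)
Lemma orth_proj_le z q p : orth_proj z q -> cube p -> enorm (q - p) <= enorm (z - p).
Proof.
move=> [cq qmin] cp.
have key s : 0 <= s <= 1 -> s * (2 * dotv (z - q) (p - q)) <= s * (s * dotv (p - q) (p - q)).
  move=> s01; have /qmin := cube_segment cq cp s01.
  rewrite -ler_sqr ?nnegrE ?enorm_ge0 // !enorm_sqr.
  have -> : z - (q + s *: (p - q)) = (z - q) - s *: (p - q) by rewrite opprD addrA.
  move: (z - q) (p - q) => {qmin} a e.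
  by rewrite !dotvE (dotvC e a); lra.
have c0 : dotv (z - q) (p - q) <= 0.
  rewrite leNgt; apply/negP => c0.
  have D0 := dotv_ge0 (p - q).
  (* Write [C] for the inner product and [D] for the squared length. If [C <= D], the optimal
     [s = C / D] turns [key] into [2 * C <= C]; otherwise [s = 1] gives [2 * C <= D < C]. *)
  have [cD|cD] := leP (dotv (z - q) (p - q)) (dotv (p - q) (p - q)).
    have Dp : 0 < dotv (p - q) (p - q) by exact: lt_le_trans cD.
    have s01 : 0 <= dotv (z - q) (p - q) / dotv (p - q) (p - q) <= 1.
      by rewrite ler_pdivrMr // mul1r cD divr_ge0 // ltW.
    have := key _ s01.
    by rewrite ler_pM2l ?divr_gt0 // divfK ?gt_eqF //; lra.
  have := key 1; rewrite ler01 lexx => /(_ erefl).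
  by move: c0 cD D0; move: (dotv _ _) (dotv _ _) => ? ? *; lra.
apply: enorm_le_sqr.
have -> : z - p = (z - q) - (p - q) by rewrite opprB addrA subrK.
rewrite -(opprB p q).
move: c0 (dotv_ge0 (z - q)); move: (p - q) (z - q) => e a.
by rewrite !dotvE (dotvC e a); lra.
Qed.

(** One projected step keeps the ball of radius [4 * rho] around [p] invariant. The two upper bounds
    on [al] serve the two cases, [y] far from [x] and [y] close to [x]. *)
Lemma enorm_step y x p G q al rho M :
  cube p -> 0 < rho -> enorm (x - p) <= rho -> enorm (y - p) <= 4 * rho ->
  dotv G (p - y) <= 2 * dotv (y - x) (p - y) ->
  dotv G G <= M -> 0 <= al -> al * M <= 8 * rho ^+ 2 -> al ^+ 2 * M <= rho ^+ 2 ->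
  orth_proj (y - al *: G) q -> enorm (q - p) <= 4 * rho.
Proof.
move=> cp rho0 xp yp HG GM al0 al1 al2 /orth_proj_le /(_ cp) /le_trans; apply.
have -> : y - al *: G - p = (y - p) - al *: G by rewrite addrAC.
have [yx|yx] := leP (2 * rho) (enorm (y - x)).
  apply: le_trans yp; apply: enorm_le_sqr.
  have dE : dotv (y - x) (p - y) = dotv (y - x) (p - x) - dotv (y - x) (y - x).
    by have -> : p - y = (p - x) - (y - x); [rewrite opprB addrA subrK | rewrite dotvDr dotvNr].
  have cs := dotv_le_enorm (y - x) (p - x).
  rewrite (enormB p x) in cs.
  (* With [r = enorm (y - x)], the left side is at most [r * (rho - r)], which is at most
     [- (2 * rho ^+ 2)] once [r >= 2 * rho]. *)
  have hh : dotv (y - x) (p - y) <= - (2 * rho ^+ 2).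
    rewrite dE -enorm_sqr.
    by have := enorm_ge0 (y - x); have := enorm_ge0 (x - p); nra.
  have h2 : dotv G (p - y) <= - (4 * rho ^+ 2) by lra.
  have -> : y - p = - (p - y) by rewrite opprB.
  (* The squared distance changes by [2 * al * dotv G e + al ^+ 2 * dotv G G], at most
     [al * (al * M - 8 * rho ^+ 2)]. *)
  move: h2 (dotv_ge0 G); move: (p - y) => e h2 G0.
  rewrite !dotvE (dotvC e G).
  have h3 : al * dotv G e <= al * - (4 * rho ^+ 2) by rewrite ler_wpM2l.
  have h4 : al * (al * dotv G G) <= al * (al * M) by rewrite !ler_wpM2l.
  have h5 : al * (al * M) <= al * (8 * rho ^+ 2) by rewrite ler_wpM2l.
  by lra.
have st : enorm (al *: G) <= rho.
  rewrite -ler_sqr ?nnegrE ?enorm_ge0 ?(ltW rho0) // enorm_sqr !dotvE.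
  apply: le_trans al2; rewrite mulrA -expr2.
  by rewrite ler_wpM2l // sqr_ge0.
(* The radius is split as [2 * rho] for [y - x], [rho] for [x - p] and [rho] for the step. *)
apply: le_trans (enormD _ _) _; rewrite enormN.
have -> : y - p = (y - x) + (x - p) by rewrite addrA subrK.
have := enormD (y - x) (x - p); lra.
Qed.

End Euclidean.

(** * Classes and penalties *)

Section Dotv_limits.
Context {R : realType} {n : nat} {T : Type} {F : set_system T} {FF : Filter F}.

Lemma cvg_coord (f : T -> 'rV[R]_n) (u : 'rV[R]_n) i :
  f x @[x --> F] --> u -> f x ord0 i @[x --> F] --> u ord0 i.
Proof.
move=> fu.
apply: (@continuous_cvg _ _ _ F FF f (fun M : 'rV[R]_n => M ord0 i) u) fu.
exact: coord_continuous.
Qed.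

Lemma cvg_dotv (f g : T -> 'rV[R]_n) (u v : 'rV[R]_n) :
  f x @[x --> F] --> u -> g x @[x --> F] --> v ->
  dotv (f x) (g x) @[x --> F] --> dotv u v.
Proof.
move=> fu gv; apply: cvg_big => [|i _]; first exact: add_continuous.
by apply: cvgM; exact: cvg_coord.
Qed.

End Dotv_limits.

Section Classification.
Context {R : realType} {n c : nat}.
Context (Z : 'rV[R]_n -> 'rV[R]_c).
Implicit Types (x y p q u v : 'rV[R]_n) (t i j : 'I_c) (s e : R).

Lemma kappa_SomeP x t :
  kappa Z x = Some t <-> forall j, j != t -> Z x ord0 j < Z x ord0 t.
Proof.
rewrite /kappa; split => [|tmax].
  by case: pickP => // i /forallP imax [<-] j jt; have /implyP := imax j; apply.
case: pickP => [i /forallP imax|/(_ t) /forallP[j]]; last exact/implyP/tmax.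
congr Some; apply: contrapT => /eqP it.
have := tmax _ it; have /implyP := imax t; rewrite eq_sym => /(_ it).
by move=> /lt_trans h /h; rewrite ltxx.
Qed.

Lemma kappa_neq_Some x t :
  kappa Z x <> Some t -> exists2 i, i != t & Z x ord0 t <= Z x ord0 i.
Proof.
move=> kx; apply: contrapT => h; apply: kx; apply/kappa_SomeP => j jt.
by rewrite ltNge; apply/negP => tj; apply: h; exists j.
Qed.

Lemma sup_others_max x t : (2 <= c)%N ->
  exists i, [/\ i != t, sup [set Z x ord0 i | i in [set~ t]] = Z x ord0 i &
    forall j, j != t -> Z x ord0 j <= Z x ord0 i].
Proof.
move=> c2; have [i1 i1t] : exists i1, i1 != t.
  (* [c2] unfolds to [1 < c], so [Ordinal c2] is class 1; [Ordinal (ltnW c2)] is class 0. *)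
  have [t0|t0] := eqVneq (val t) 0%N.
    by exists (Ordinal c2); rewrite -val_eqE /= t0.
  by exists (Ordinal (ltnW c2)); rewrite -val_eqE eq_sym.
have [i it imax] := @arg_maxP _ R _ i1 (fun i => i != t) (fun i => Z x ord0 i) i1t.
exists i; split => //; apply/eqP; rewrite eq_le; apply/andP; split.
  apply: ge_sup; first by exists (Z x ord0 i), i => //=; apply/eqP.
  by move=> _ [j /= /eqP jt <-]; exact: imax.
apply: ub_le_sup; last by exists i => //=; apply/eqP.
by exists (Z x ord0 i) => _ [j /= /eqP jt <-]; exact: imax.
Qed.

Lemma penalty_le x t i e : (2 <= c)%N -> 0 <= e -> i != t ->
  Z x ord0 t - Z x ord0 i <= e -> penalty Z t x <= e.
Proof.
move=> c2 e0 it h; have [j [jt supE jmax]] := sup_others_max x t c2.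
rewrite /penalty supE ge_max e0 andbT.
by have := jmax _ it; lra.
Qed.

(** The penalty is a truncated difference of two logits, each moving by at most [e]; one-sided
    bounds suffice by symmetry. *)
Lemma penalty_lipschitz x y t e : (2 <= c)%N ->
  (forall i, `|Z y ord0 i - Z x ord0 i| <= e) ->
  `|penalty Z t y - penalty Z t x| <= 2 * e.
Proof.
move=> c2; have half x' y' : (forall i, `|Z y' ord0 i - Z x' ord0 i| <= e) ->
    penalty Z t y' <= penalty Z t x' + 2 * e.
  move=> h; have [i [it supE _]] := sup_others_max x' t c2.
  have e0 : 0 <= e by exact: le_trans (h t).
  have := h t; have := h i; rewrite !ler_norml => /andP[i1 i2] /andP[t1 t2].
  have : penalty Z t x' >= Z x' ord0 t - Z x' ord0 i.
    by rewrite /penalty supE le_max lexx.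
  have : penalty Z t x' >= 0 by rewrite /penalty le_max lexx orbT.
  by move=> *; apply: (penalty_le c2 _ it); lra.
move=> h; rewrite ler_norml; have h1 := half _ _ h.
have h2 : penalty Z t x <= penalty Z t y + 2 * e.
  by apply: half => i; rewrite distrC.
by apply/andP; split; lra.
Qed.

Lemma polytope_segment (Q : set 'rV[R]_n) p q s :
  polytope Q -> Q p -> Q q -> 0 <= s <= 1 -> Q (q + s *: (p - q)).
Proof.
move=> [_ [m [A [b ->]]]] /= Qp Qq /andP[s0 s1] j.
rewrite mulmxDl -scalemxAl mulmxBl !mxE.
have := Qp j; have := Qq j; rewrite !mxE => *; nra.
Qed.

Lemma polytope_closed (Q : set 'rV[R]_n) : polytope Q -> closed Q.
Proof.
move=> [_ [m [A [b ->]]]].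
have -> : [set x : 'rV[R]_n | forall k, (x *m A) ord0 k <= b ord0 k] =
    \bigcap_k (fun x => dotv x (\row_l A l k)) @^-1` [set r : R | r <= b ord0 k].
  have dotvE x k : (x *m A) ord0 k = dotv x (\row_l A l k).
    by rewrite mxE; apply: eq_bigr => l _; rewrite mxE.
  apply/seteqP; split => [x /= h k _ /=|x h k]; first by rewrite -dotvE.
  by rewrite dotvE; exact: h.
apply: closed_bigI => k _.
have fc : continuous (fun x : 'rV[R]_n => dotv x (\row_l A l k)).
  by move=> x; apply: (@cvg_dotv _ _ _ (nbhs x) _ id); [exact: cvg_id | exact: cvg_cst].
by have /continuous_closedP := fc; apply; exact: closed_le.
Qed.

(* The functions x |-> Z x t - Z x i are affine along the segment from u to p,
   and the smallest of them at u is nonpositive at p. *)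
Lemma penalty_segment (Q : set 'rV[R]_n) (W : 'M[R]_(n, c)) (b : 'rV[R]_c) t p u s :
  (2 <= c)%N -> polytope Q -> (forall x, Q x -> Z x = x *m W + b) ->
  Q p -> Q u ->
  (forall i j, Z p ord0 i < Z p ord0 j -> Z u ord0 i < Z u ord0 j) ->
  kappa Z p <> Some t -> 0 <= s <= 1 ->
  penalty Z t (u + s *: (p - u)) <= penalty Z t u.
Proof.
move=> c2 pQ ZW Qp Qu loc /kappa_neq_Some[i1 i1t pi1] s01.
have [i [it supE imax]] := sup_others_max u t c2.
(* Otherwise [i] is strictly below [i1] at [p], hence at [u] by [loc], although [i] is the strongest
   competitor of [t] at [u]. *)
have pti : Z p ord0 t <= Z p ord0 i.
  rewrite leNgt; apply/negP => /lt_le_trans /(_ pi1) /loc.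
  by rewrite ltNge imax.
have pen0 : 0 <= penalty Z t u by rewrite /penalty le_max lexx orbT.
have pen1 : Z u ord0 t - Z u ord0 i <= penalty Z t u.
  by rewrite /penalty supE le_max lexx.
apply: (penalty_le c2 _ it) => //.
have ZE k : Z (u + s *: (p - u)) ord0 k = Z u ord0 k + s * (Z p ord0 k - Z u ord0 k).
  rewrite !ZW //; last exact: polytope_segment.
  by rewrite mulmxDl -scalemxAl mulmxBl !mxE; ring.
rewrite !ZE; case/andP: s01 => s0 s1; nra.
Qed.

End Classification.

(** * Clarke gradients *)

Section Gradients.
Context {R : realType} {n : nat}.
Implicit Types (g : 'rV[R]_n -> R) (x y p q u v G : 'rV[R]_n).

Lemma dotv_grad g u v : differentiable g u -> dotv (grad g u) v = 'D_v g u.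
Proof.
move=> dg; rewrite deriveE // {2}(row_sum_delta v) linear_sum.
by apply: eq_bigr => i _; rewrite linearZ /grad mxE deriveE // mulrC.
Qed.

(** Sampling the difference quotient along a sequence lets estimates that hold only for infinitely
    many indices be used. *)
Lemma derive_harmonic g u v : differentiable g u ->
  (harmonic m)^-1 * (g (harmonic m *: v + u) - g u) @[m --> \oo] --> 'D_v g u.
Proof.
move=> /(@diff_derivable _ _ _ _ _ v) dg.
have h0 : harmonic m @[m --> \oo] --> (0 : R)^'.
  move=> A [e e0 eA]; have /cvgrPdist_lt /(_ e e0) := @cvg_harmonic R.
  by apply: filterS => m me; apply: eA => //; rewrite gt_eqF // harmonic_gt0.
exact: cvg_comp h0 dg.
Qed.

Lemma derive_le g u v (K L : R) : differentiable g u ->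
  (forall s, 0 < s <= 1 -> g (s *: v + u) - g u <= s * (K + s * L)) ->
  'D_v g u <= K.
Proof.
move=> /(@derive_harmonic _ _ v) dg gKL.
have KL : K + harmonic m * L @[m --> \oo] --> K.
  rewrite -[X in _ --> X]addr0 -[X in _ --> _ + X](mul0r L).
  by apply: cvgD; [exact: cvg_cst | apply: cvgM; [exact: cvg_harmonic | exact: cvg_cst]].
apply: (ler_cvg_to dg KL); near=> m.
have h0 := @harmonic_gt0 R m.
rewrite mulrC ler_pdivrMr // mulrC; apply: gKL; rewrite h0 /=.
by rewrite /harmonic /= invf_le1 ?ler1n.
Unshelve. all: by end_near. Qed.

Lemma frequently_le_lim (f : nat -> R) (l C : R) : f m @[m --> \oo] --> l ->
  (forall M, exists2 m, (M <= m)%N & f m <= C) -> l <= C.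
Proof.
move=> fl fC; rewrite leNgt; apply/negP => Cl.
have [M _ HM] := cvgr_gt _ fl _ Cl.
by have [m /HM /=] := fC M; rewrite ltNge => /negP.
Qed.

(** Coordinate bounds survive limits of gradients and convex combinations. *)
Lemma clarke_coord_le g y G (C : R) :
  (forall u i, interior cube u -> differentiable g u -> `|grad g u ord0 i| <= C) ->
  clarke g y G -> forall i, `|G ord0 i| <= C.
Proof.
move=> gC [m [w [V [w0 w1 HV ->]]]] i.
rewrite summxE; apply: le_trans (ler_norm_sum _ _ _) _.
rewrite -[leRHS]mul1r -w1 mulr_suml; apply: ler_sum => k _.
rewrite mxE normrM ger0_norm // ler_wpM2l //.
have [u [uin _ gu]] := HV k.
have gui : `|grad g (u j) ord0 i| @[j --> \oo] --> `|V k ord0 i|.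
  by apply: cvg_norm; exact: cvg_coord.
apply: (cvgr_to_le gui).
by apply: nearW => j; have [? ?] := uin j; exact: gC.
Qed.

(** The inequality is linear in the gradient and continuous in the base point, so it passes to
    limits and then to convex combinations. *)
Lemma dotv_clarke_le g x y p G (e : R) : 0 < e -> enorm (y - p) < e ->
  (forall u, interior cube u -> ball p e u -> differentiable g u ->
     dotv (grad g u) (p - u) <= 2 * dotv (u - x) (p - u)) ->
  clarke g y G -> dotv G (p - y) <= 2 * dotv (y - x) (p - y).
Proof.
move=> e0 yp gle [m [w [V [w0 w1 HV ->]]]].
have -> : dotv (\sum_i w i *: V i) (p - y) = \sum_i w i * dotv (V i) (p - y).
  apply: (big_ind2 (fun a b => dotv a (p - y) = b)).
  - by rewrite -(scale0r 0) dotvZl mul0r.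
  - by move=> ? ? ? ? <- <-; rewrite dotvDl.
  - by move=> i _; rewrite dotvZl.
rewrite -[leRHS]mul1r -[X in X * (2 * _)]w1 mulr_suml; apply: ler_sum => k _.
rewrite ler_wpM2l //.
have [u [uin uy gu]] := HV k.
have pu : p - u j @[j --> \oo] --> p - y by apply: cvgB => //; exact: cvg_cst.
have ux : u j - x @[j --> \oo] --> y - x by apply: cvgB => //; exact: cvg_cst.
have lim2 : 2 * dotv (u j - x) (p - u j) @[j --> \oo] --> 2 * dotv (y - x) (p - y).
  by apply: cvgM; [exact: cvg_cst | exact: cvg_dotv].
have lim1 : dotv (grad g (u j)) (p - u j) @[j --> \oo] --> dotv (V k) (p - y).
  exact: cvg_dotv.
apply: (ler_cvg_to lim1 lim2).
(* [ball] refers to the sup norm, which the Euclidean norm dominates. *)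
have py : ball p e y.
  split => // i0 i; rewrite (ord1 i0) /ball /= distrC.
  by apply: le_lt_trans yp; have := enorm_coord (y - p) i; rewrite !mxE.
have near_ball : \forall j \near \oo, ball p e (u j).
  by apply: uy; apply: open_nbhs_nbhs; split => //; exact: ball_open.
by apply: filterS near_ball => j pj; have [? ?] := uin j; exact: gle.
Qed.

End Gradients.

(** * Local geometry of the network *)

Section Network.
Context {R : realType} {n c N : nat}.
Context (Z : 'rV[R]_n -> 'rV[R]_c) (Q : 'I_N -> set 'rV[R]_n).
Context (c2 : (2 <= c)%N) (ZQ : relu_logits Z Q).
Implicit Types (x y p q u v G : 'rV[R]_n) (t i j : 'I_c) (s e b : R).

(** Near [p] the polytopes look like cones with apex [p]: each point [u] of the cube shares a
    polytope with [p], so the segment from [u] to [p] stays in one affine piece. Strict order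
    relations between logits at [p] persist at [u]. *)
Definition conic_at p (e : R) := forall u, cube u -> ball p e u ->
  (exists2 l, Q l u & Q l p) /\
  forall i j, Z p ord0 i < Z p ord0 j -> Z u ord0 i < Z u ord0 j.

(** The finitely many closed polytopes missing [p] also miss a neighbourhood of it, and finitely
    many strict inequalities between continuous logits persist. *)
Lemma conic_at_exists p : cube p -> exists2 e, 0 < e & conic_at p e.
Proof.
case: ZQ => Zc pQ covQ _ cp.
have nQ : \forall u \near p, forall l, ~ Q l p -> ~ Q l u.
  apply: (@filter_forall _ _ (fun l u => ~ Q l p -> ~ Q l u) (nbhs p)) => l.
  have [Qp|Qp] := pselect (Q l p); first by apply: (@filterE _ (nbhs p)).
  have /closed_openC oQ := polytope_closed (pQ l).
  by apply: (@filterS _ (nbhs p)) (open_nbhs_nbhs (conj oQ Qp)).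
have nZ : \forall u \near p, cube u ->
    forall i j, Z p ord0 i < Z p ord0 j -> Z u ord0 i < Z u ord0 j.
  have Zp : Z u @[u --> within cube (nbhs p)] --> Z p.
    have /(_ p) := Zc; rewrite /continuous_at.
    by rewrite nbhs_subspace_in.
  suff : \forall u \near within cube (nbhs p),
      forall i j, Z p ord0 i < Z p ord0 j -> Z u ord0 i < Z u ord0 j.
    by [].
  apply: (@filter_forall _ _ (fun i u => forall j, _) (within _ _)) => i.
  apply: (@filter_forall _ _ (fun j u => _ -> _) (within _ _)) => j.
  have [ij|/negP ij] := boolP (Z p ord0 i < Z p ord0 j); last by apply: (@filterE _ (within _ _)).
  have d0 : 0 < Z p ord0 j - Z p ord0 i by rewrite subr_gt0.
  have dc : Z u ord0 j - Z u ord0 i @[u --> within cube (nbhs p)] -->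
      Z p ord0 j - Z p ord0 i by apply: (@cvgB _ _ _ (within _ _)); exact: cvg_coord.
  by apply: (@filterS _ (within _ _)) (cvgr_gt _ dc _ d0) => u; rewrite subr_gt0.
have [e /= e0 eP] := (nbhs_ballP p _).1 (filterI nQ nZ).
exists e => // u cu /eP[uQ uZ]; split; last exact: uZ.
have [l _ Ql] : (\bigcup_l Q l) u by rewrite covQ.
by exists l => //; apply: contrapT => /uQ.
Qed.

Lemma kappa_conic p e u t : cube u -> ball p e u -> conic_at p e ->
  kappa Z p = Some t -> kappa Z u = Some t.
Proof.
by move=> cu pu /(_ _ cu pu)[_ loc] /kappa_SomeP h; apply/kappa_SomeP => j /h /loc.
Qed.

Lemma closure_ball (A : set 'rV[R]_n) p e : 0 < e -> closure A p ->
  exists2 u, A u & ball p e u.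
Proof. by move=> e0 /(_ _ (nbhsx_ballx p e e0))[u [Au pu]]; exists u. Qed.

(** Having class [t2] is an open condition in the cube, whereas points of class [t] accumulate at
    [p]. *)
Lemma kappa_closure_infeasible p t t2 : cube p -> closure (infeasible Z t) p ->
  t2 <> t -> kappa Z p <> Some t2.
Proof.
move=> cp clp t2t kp; have [e e0 pe] := conic_at_exists cp.
have [u [cu ku] pu] := closure_ball e0 clp.
by apply: t2t; have := kappa_conic cu pu pe kp; rewrite ku => -[].
Qed.

Lemma kappa_closure_feasible p t : cube p -> closure (feasible Z t) p ->
  kappa Z p <> Some t.
Proof.
move=> cp clp kp; have [e e0 pe] := conic_at_exists cp.
have [u [cu ku] pu] := closure_ball e0 clp.
by apply: ku; exact: kappa_conic cu pu pe kp.
Qed.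

Lemma objective_quotient t b x u v s :
  objective Z t b x (s *: v + u) - objective Z t b x u =
  s * (2 * dotv (u - x) v + s * dotv v v) +
  b * (penalty Z t (s *: v + u) - penalty Z t u).
Proof.
rewrite /objective !enorm_sqr.
have -> : s *: v + u - x = s *: v + (u - x) by rewrite addrA.
move: (u - x) => w; rewrite !dotvE (dotvC w v); ring.
Qed.

(** In the direction [p - u] the penalty does not increase, so only the derivative of the squared
    distance remains and the bound is free of [b]. *)
Lemma grad_objective_le t b x p e u : conic_at p e -> cube p -> kappa Z p <> Some t ->
  0 <= b -> interior cube u -> ball p e u -> differentiable (objective Z t b x) u ->
  dotv (grad (objective Z t b x) u) (p - u) <= 2 * dotv (u - x) (p - u).
Proof.
move=> pe cp kp b0 /interior_subset cu pu dF.
rewrite dotv_grad //; apply: (derive_le (L := dotv (p - u) (p - u))) => // s /andP[s0 s1].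
rewrite objective_quotient gerDl mulr_ge0_le0 // subr_le0 addrC.
have [[l Qu Qp] loc] := pe _ cu pu.
case: ZQ => _ pQ _ /(_ l)[W [a ZW]].
by apply: (penalty_segment c2 (pQ l) ZW Qp Qu loc kp); rewrite ltW.
Qed.

(** By pigeonhole, one polytope contains infinitely many points of the sequence approaching [u].
    There the logits are affine with one of finitely many weight matrices. *)
Lemma logits_slope : exists L : R, forall u v, interior cube u ->
  (forall k, `|v ord0 k| <= 1) -> forall M, exists2 m, (M <= m)%N &
    forall i, `|Z (harmonic m *: v + u) ord0 i - Z u ord0 i| <= harmonic m * L.
Proof.
case: ZQ => _ pQ covQ /(_ _)/cid/= ZW.
pose W l := projT1 (ZW l).
have ZE l : exists a, forall x, Q l x -> Z x = x *m W l + a by exact: projT2 (ZW l).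
(* The sum over all pieces, classes and inputs dominates every slope, uniformly in [u] and [v]. *)
exists (\sum_l \sum_i \sum_k `|W l k i|) => u v iu v1 M.
have uv : harmonic m *: v + u @[m --> \oo] --> u.
  have hv : harmonic m *: v @[m --> \oo] --> (0 : R) *: v.
    by apply: cvgZ; [exact: cvg_harmonic | exact: cvg_cst].
  have : harmonic m *: v + u @[m --> \oo] --> (0 : R) *: v + u.
    by apply: cvgD => //; exact: cvg_cst.
  by rewrite scale0r add0r.
have [l Ql] : exists l, forall M, exists2 m, (M <= m)%N & Q l (harmonic m *: v + u).
  apply: contrapT => nl.
  have nQ : \forall m \near \oo, forall l, ~ Q l (harmonic m *: v + u).
    apply: filter_forall => l; apply: contrapT => nQl; apply: nl; exists l => M'.
    apply: contrapT => h; apply: nQl; exists M' => // m /= M'm Qm.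
    by apply: h; exists m.
  have nC : \forall m \near \oo, cube (harmonic m *: v + u) by exact: uv.
  have [m [Qm]] := @filter_ex _ _ _ _ (filterI nQ nC).
  by rewrite -covQ => -[l _ /Qm].
(* Closedness puts the limit [u] in the same polytope, so both ends of the quotient use the same
   affine formula. *)
have Qu : Q l u.
  apply: contrapT => nQu; have /closed_openC oQ := polytope_closed (pQ l).
  have [M' _ hM'] : \forall m \near \oo, ~ Q l (harmonic m *: v + u).
    exact: uv _ (open_nbhs_nbhs (conj oQ nQu)).
  by have [m /hM'] := Ql M'.
have [m Mm Qm] := Ql M; exists m => // i.
have [a Za] := ZE l.
have -> : Z (harmonic m *: v + u) ord0 i - Z u ord0 i =
    harmonic m * (v *m W l) ord0 i.
  by rewrite !Za // mulmxDl -scalemxAl !mxE; ring.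
rewrite normrM (ger0_norm (harmonic_ge0 _)) ler_wpM2l ?harmonic_ge0 //.
rewrite mxE; apply: le_trans (ler_norm_sum _ _ _) _.
have term (T : finType) (f : T -> R) z : (forall z', 0 <= f z') -> f z <= \sum_z' f z'.
  by move=> f0; rewrite (bigD1 z) //= lerDl sumr_ge0.
apply: le_trans (term _ (fun l => \sum_i \sum_k `|W l k i|) l _) => [|l']; last first.
  by rewrite !sumr_ge0 // => *; rewrite sumr_ge0.
apply: le_trans (term _ (fun i => \sum_k `|W l k i|) i _) => [|i']; last first.
  by rewrite sumr_ge0.
by apply: ler_sum => k _; rewrite normrM -[leRHS]mul1r ler_wpM2r.
Qed.

Lemma grad_objective_bound : exists2 L : R, 0 <= L & forall t b x u k,
  cube x -> 0 <= b -> interior cube u -> differentiable (objective Z t b x) u ->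
  `|grad (objective Z t b x) u ord0 k| <= 3 + 2 * b * L.
Proof.
have [L0 HL] := logits_slope.
exists `|L0| => // t b x u k cx b0 iu dF.
(* The 3 collects [2 * dotv (u - x) v <= 2] and [h * dotv v v <= 1]; the last term comes from
   [penalty_lipschitz]. *)
have dv v : (forall k, `|v ord0 k| <= 1) -> dotv v v <= 1 -> dotv (u - x) v <= 1 ->
    'D_v (objective Z t b x) u <= 3 + 2 * b * `|L0|.
  move=> v1 vv uv.
  have lim := @derive_harmonic _ _ _ _ v dF.
  apply: (frequently_le_lim lim) => M.
  have [m Mm Hm] := HL u v iu v1 M.
  exists m => //.
  have h0 := @harmonic_gt0 R m.
  have h1 : harmonic m <= 1 :> R by rewrite /harmonic /= invf_le1 ?ler1n.
  rewrite mulrC ler_pdivrMr // mulrC objective_quotient.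
  have := penalty_lipschitz t c2 Hm; rewrite ler_norml => /andP[_ pl].
  have := ler_wpM2l b0 pl.
  have : harmonic m * L0 <= harmonic m * `|L0| by rewrite ler_pM2l // ler_norm.
  move: pl Hm h0 h1; move: (harmonic m) => h pl Hm h0 h1 hL hb.
  have hbL : b * (h * L0) <= b * (h * `|L0|) by rewrite ler_wpM2l.
  have : h * (2 * dotv (u - x) v + h * dotv v v) <= h * 3.
    rewrite ler_pM2l //; have : 0 <= dotv v v by exact: dotv_ge0.
    by move: vv uv; move: (dotv v v) (dotv _ v) => *; nra.
  by lra.
have gE : grad (objective Z t b x) u ord0 k = 'D_(delta_mx ord0 k) (objective Z t b x) u.
  by rewrite mxE.
have dk z : dotv z (delta_mx ord0 k) = z ord0 k.
  rewrite /dotv (bigD1 k) //= big1 ?addr0 ?mxE ?eqxx ?mulr1 // => i /negPf ik.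
  by rewrite mxE ik mulr0.
have uxk : `|(u - x) ord0 k| <= 1.
  rewrite !mxE ler_norml; have /andP[? ?] := interior_subset iu k.
  have /andP[? ?] := cx k.
  by apply/andP; split; lra.
rewrite ler_norml gE; move: uxk; rewrite ler_norml => /andP[ux1 ux2].
have dv1 (i : 'I_n) : `|(delta_mx ord0 k : 'rV[R]_n) ord0 i| <= 1.
  by rewrite mxE; case: (_ && _); rewrite ?normr0 ?normr1.
apply/andP; split; last first.
  apply: dv => //; last by rewrite dk.
  by rewrite dk mxE !eqxx.
(* The lower bound is the upper bound in the opposite coordinate direction. *)
rewrite lerNl -dotv_grad // -dotvNr dotv_grad //; apply: dv => [i||].
- by rewrite mxE normrN.
- by rewrite !dotvE opprK dk mxE !eqxx.
- by rewrite dotvNr dk; lra.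
Qed.

End Network.

(** * The counter attack *)

(** Induction with [enorm_step] confines the iterates to the ball of radius [4 * rho] around [p];
    the fifth [rho] is the distance from [x] to [p]. The threshold [A] depends on [rho] and [b]
    only. *)
Lemma counter_attack_close (R : realType) (n c N : nat) (Z : 'rV[R]_n -> 'rV[R]_c)
    (Q : 'I_N -> set 'rV[R]_n) : (2 <= c)%N -> relu_logits Z Q ->
  exists2 A : R -> R -> R, (forall rho b, 0 < rho -> 0 < A rho b) &
    forall p e x t rho b beta y jstar,
      cube p -> conic_at Z Q p e -> cube x -> kappa Z p <> Some t ->
      0 < rho -> enorm (x - p) <= rho -> 4 * rho < e -> 0 < b ->
      admissible beta -> beta 0%N <= A rho b ->
      counter_attack Z t b beta x y jstar -> enorm (x - y jstar) <= 5 * rho.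
Proof.
move=> c2 ZQ; have [L L0 HL] := grad_objective_bound c2 ZQ.
(* Bounds the squared norm of every Clarke gradient, through its [n] coordinates. The added 1
   ensures [M b >= 1], so that a step size with [al * M b <= rho] also satisfies [al <= rho]. *)
pose M b : R := 1 + n%:R * (3 + 2 * b * L) ^+ 2.
have M1 b : 1 <= M b by rewrite lerDl mulr_ge0 // sqr_ge0.
have M0 b : 0 < M b by exact: lt_le_trans (M1 b).
exists (fun rho b => Num.min (8 * rho ^+ 2 / M b) (rho / M b)) => [rho b rho0|].
  by rewrite lt_min !divr_gt0 // mulr_gt0 // exprn_gt0.
move=> p e x t rho b beta y jstar cp pe cx kp rho0 xp rhoe b0 [beta0 betaS _ _ _].
rewrite le_min => /andP[bA1 bA2] [y0 ystep _].
have beta_le j : beta j <= beta 0%N.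
  by elim: j => // j; exact: le_trans (betaS j).
have close j : (j <= jstar)%N -> enorm (y j - p) <= 4 * rho.
  elim: j => [_|j IH jj]; first by rewrite y0; lra.
  have [[G clG Gproj] _] := ystep j jj.
  have yp := IH (ltnW jj).
  have HG := dotv_clarke_le (le_lt_trans (enorm_ge0 _) (le_lt_trans yp rhoe))
    (le_lt_trans yp rhoe)
    (fun u iu pu dF => grad_objective_le c2 ZQ pe cp kp (ltW b0) iu pu dF) clG.
  have GC := clarke_coord_le
    (fun u i iu dF => HL t b x u i cx (ltW b0) iu dF) clG.
  have GM : dotv G G <= M b.
    apply: (@le_trans _ _ (n%:R * (3 + 2 * b * L) ^+ 2)); last by rewrite lerDr.
    rewrite -[n in n%:R]card_ord mulr_natl -sumr_const; apply: ler_sum => i _.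
    rewrite -expr2 -[leLHS]real_normK ?num_real // ler_sqr ?nnegrE //.
    by rewrite addr_ge0 // !mulr_ge0 // ltW.
  apply: (enorm_step cp rho0 xp yp HG GM (ltW (beta0 j)) _ _ Gproj).
    by rewrite -ler_pdivlMr //; exact: le_trans (beta_le j) bA1.
  have bj : beta j * M b <= rho.
    by rewrite -ler_pdivlMr //; exact: le_trans (beta_le j) bA2.
  have bj' : beta j <= rho.
    by apply: le_trans bj; rewrite ler_peMr // ltW.
  rewrite expr2 -mulrA expr2; apply: ler_pM => //; first exact: ltW.
  by rewrite mulr_ge0 // ltW.
have -> : x - y jstar = (x - p) + (p - y jstar) by rewrite addrA subrK.
apply: le_trans (enormD _ _) _.
by have := close _ (leqnn _); rewrite (enormB p); lra.
Qed.

(** * Convergence of the AUROC *)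

Section Probability.
Context {R : realType} {d : measure_display} {Omega : measurableType d}.
Context (P : probability Omega R).

(** Almost sure convergence implies convergence in probability: the tail unions [B K] decrease to a
    null set, and [P] is continuous from above. *)
Lemma probability_eventually_not (E : nat -> set Omega) :
  (forall k, measurable (E k)) ->
  {ae P, forall w, \forall k \near \oo, ~ E k w} ->
  forall e : R, 0 < e -> \forall k \near \oo, (P (E k) <= e%:E)%E.
Proof.
move=> mE ae_E e e0; pose B K := \bigcup_(k in [set k | (K <= k)%N]) E k.
have mB K : measurable (B K) by exact: bigcup_measurable.
have B0 : P (\bigcap_K B K) = 0%E.
  apply: measure_negligible; first exact: bigcapT_measurable.
  apply: negligibleS ae_E => w Bw [K _ KE].
  by have [k /KE] := Bw K Logic.I.
have : P (B k) @[k --> \oo] --> 0%E.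
  rewrite -B0; apply: nonincreasing_cvg_mu => //.
  - by rewrite (le_lt_trans (probability_le1 _ (mB _))) ?ltry.
  - exact: bigcapT_measurable.
  - move=> K K' KK'; apply/subsetPset => w [k /= K'k Ekw].
    by exists k => //=; exact: leq_trans K'k.
move=> /fine_cvgP[_] Bcvg; apply: filterS (cvgr_lt _ Bcvg _ e0) => k /ltW Bke.
apply: (@le_trans _ _ (P (B k))).
  by apply: le_measure; rewrite ?inE // => w Ekw; exists k => /=.
by rewrite -[P _]fineK ?fin_num_measure.
Qed.

Lemma probability_ge_setC (A : set Omega) (e : R) : measurable A ->
  (P (~` A) <= e%:E)%E -> ((1 - e)%:E <= P A)%E.
Proof.
move=> mA; rewrite probability_setC // -[P A]fineK ?fin_num_measure //.
by rewrite -EFinB !lee_fin => h; lra.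
Qed.

Section Auroc.
Context (D D' : Omega -> R).
Context (mD : measurable_fun setT D) (mD' : measurable_fun setT D').

Lemma measurable_le_fun (f : Omega -> R) (r : R) : measurable_fun setT f ->
  measurable [set w | f w <= r].
Proof.
move=> mf; rewrite -[X in measurable X]setTI.
by have := mf measurableT `]-oo, r]%classic (measurable_itv _); rewrite set_itvE.
Qed.

Lemma measurable_cdf (A : set R) : measurable A ->
  measurable_fun A (fun tau => P [set w | D w <= tau]).
Proof.
move=> mA.
have -> : (fun tau => P [set w | D w <= tau]) =
    (fun tau => (fine (P [set w | D w <= tau]))%:E).
  by apply/funext => tau; rewrite fineK // fin_num_measure //; exact: measurable_le_fun.
apply/measurable_EFinP; apply: nondecreasing_measurable => // s t st.
rewrite fine_le ?fin_num_measure //; try exact: measurable_le_fun.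
apply: le_measure; rewrite ?inE; try exact: measurable_le_fun.
by move=> w /= /le_trans; apply.
Qed.

(** Packages [D'] so that its law is a [distribution], hence a probability measure. *)
Let X : {mfun Omega >-> R} := HB.pack D' (isMeasurableFun.Build _ _ _ _ D' mD').

Lemma auroc_le1 : (auroc P D D' <= 1)%E.
Proof.
apply: (@le_trans _ _ (\int[distribution P X]_(tau in `[0%R, +oo[) cst 1 tau)%E).
  apply: (@ge0_le_integral _ _ _ (distribution P X)) => //.
  - exact: measurable_cdf.
  - by move=> tau _; apply: probability_le1; exact: measurable_le_fun.
by rewrite integral_cst // mul1e probability_le1.
Qed.

(** On [[tau, +oo[] the distribution function of [D] is at least its value at [tau], and this
    half-line has mass [P (tau <= D')]. *)
Lemma auroc_ge (tau : R) : 0 <= tau ->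
  (P [set w | (D w <= tau)%R] * P [set w | (tau <= D' w)%R] <= auroc P D D')%E.
Proof.
move=> tau0.
have -> : P [set w | tau <= D' w] = distribution P X `[tau, +oo[%classic.
  by congr (P _); apply/seteqP; split => w /=; rewrite in_itv /= andbT.
rewrite -integral_cst //.
apply: (@le_trans _ _
    (\int[distribution P X]_(r in `[tau, +oo[) P [set w | (D w <= r)%R])%E).
  apply: ge0_le_integral => //; first exact: measurable_cdf.
  move=> r /=; rewrite in_itv /= andbT => tr.
  apply: le_measure; rewrite ?inE; try exact: measurable_le_fun.
  by move=> w /= /le_trans; apply.
apply: (@ge0_subset_integral _ _ _ (distribution P X)) => //.
  exact: measurable_cdf.
by move=> r /=; rewrite !in_itv /= !andbT; exact: le_trans.
Qed.

End Auroc.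

(** The limit [l] is positive but possibly not bounded away from 0, so a separating level [tau] is
    chosen outside an event of small probability; [auroc_ge] at [tau] concludes. *)
Lemma auroc_cvg1 (D D' : nat -> Omega -> R) (l : Omega -> R) :
  (forall k, measurable_fun setT (D k)) -> (forall k, measurable_fun setT (D' k)) ->
  measurable_fun setT l ->
  {ae P, forall w, D k w @[k --> \oo] --> 0} ->
  {ae P, forall w, D' k w @[k --> \oo] --> l w} ->
  {ae P, forall w, 0 < l w} ->
  auroc P (D k) (D' k) @[k --> \oo] --> 1%E.
Proof.
move=> mD mD' ml D0 D'l l0.
suff near1 (e : R) : 0 < e < 1 ->
    \forall k \near \oo, ((1 - e)%:E <= auroc P (D k) (D' k))%E.
  have fin : \forall k \near \oo, auroc P (D k) (D' k) \is a fin_num.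
    have half : 0 < (2^-1 : R) < 1 by apply/andP; split; lra.
    apply: filterS (near1 _ half) => k h; apply/fin_real/andP; split.
      exact: lt_le_trans (ltNyr _) h.
    exact: le_lt_trans (auroc_le1 (mD k) (mD' k)) (ltry _).
  apply/fine_cvgP; split => //; apply/cvgrPdist_le => e e0.
  pose e' := Num.min e 2^-1.
  have e'01 : 0 < e' < 1.
    apply/andP; split; first by rewrite lt_min e0 invr_gt0 ltr0n.
    by apply: (@le_lt_trans _ _ (2^-1 : R)); [rewrite ge_min lexx orbT | lra].
  apply: filterS2 fin (near1 _ e'01) => k fk.
  have := auroc_le1 (mD k) (mD' k).
  rewrite -[auroc _ _ _]fineK // !lee_fin => h1 h2.
  have : e' <= e by rewrite ge_min lexx.
  by rewrite ger0_norm /=; lra.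
(* With [e3 = e / 4], the final product [(1 - e3) * (1 - 2 * e3)] is at least [1 - 3 * e3], hence at
   least [1 - e]. *)
move=> /andP[e0 e1]; pose e3 := e / 4.
have e30 : 0 < e3 by rewrite divr_gt0.
have [tau tau0 Htau] : exists2 tau : R, 0 < tau & (P [set w | (l w <= 2 * tau)%R] <= e3%:E)%E.
  have /(_ _ _ e3 e30)[||m _ /(_ m (leqnn m)) h] := @probability_eventually_not
      (fun m => [set w | l w <= 2 * harmonic m]).
  - by move=> m; exact: measurable_le_fun.
  - apply: filterS l0 => w lw.
    have h2 : 2 * harmonic m @[m --> \oo] --> (2 * 0 : R).
      by apply: cvgM; [exact: cvg_cst | exact: cvg_harmonic].
    rewrite mulr0 in h2.
    by apply: filterS (cvgr_lt _ h2 _ lw) => m; rewrite ltNge => /negP.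
  - by exists (harmonic m); [exact: harmonic_gt0 | exact: h].
have nD := @probability_eventually_not (fun k => ~` [set w | D k w <= tau]) _ _ e3 e30.
have nD' := @probability_eventually_not
  (fun k => [set w | 2 * tau < l w] `&` [set w | D' k w < tau]) _ _ e3 e30.
have mgt (f : Omega -> R) r : measurable_fun setT f -> measurable [set w | r < f w].
  move=> mf; have -> : [set w | r < f w] = ~` [set w | f w <= r].
    by apply/seteqP; split => w /=; rewrite ltNge => /negP.
  by apply: measurableC; exact: measurable_le_fun.
have mge (f : Omega -> R) r : measurable_fun setT f -> measurable [set w | r <= f w].
  move=> mf; rewrite -[X in measurable X]setTI.
  by have := mf measurableT `[r, +oo[%classic (measurable_itv _); rewrite set_itvE.
have mlt (f : Omega -> R) r : measurable_fun setT f -> measurable [set w | f w < r].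
  move=> mf; have -> : [set w | f w < r] = ~` [set w | r <= f w].
    by apply/seteqP; split => w /=; rewrite ltNge => /negP.
  by apply: measurableC; exact: mge.
have mEk k : measurable ([set w | 2 * tau < l w] `&` [set w | D' k w < tau]).
  by apply: measurableI; [exact: mgt | exact: mlt].
near=> k.
have h1 : (P (~` [set w | (D k w <= tau)%R]) <= e3%:E)%E.
  near: k; apply: nD => [k|].
    by apply: measurableC; exact: measurable_le_fun.
  apply: filterS D0 => w Dw.
  by apply: filterS (cvgr_lt _ Dw _ tau0) => k Dk /=; apply; exact: ltW.
have h2 : (P ([set w | (2 * tau < l w)%R] `&` [set w | (D' k w < tau)%R]) <= e3%:E)%E.
  near: k; apply: nD' => [k|]; first exact: mEk.
  apply: filterS2 l0 D'l => w lw D'w.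
  have [tl|tl] := ltP (2 * tau) (l w); last first.
    by apply: nearW => k [/=]; rewrite ltNge tl.
  have tl' : tau < l w by lra.
  by apply: filterS (cvgr_gt _ D'w _ tl') => k /ltW; rewrite leNgt => /negP h [_ /=].
have h3 : (P (~` [set w | (tau <= D' k w)%R]) <= (2 * e3)%:E)%E.
  (* [D' < tau] happens either where [l] is small or where [D'] is still far from its limit; each
     case costs [e3]. *)
  apply: (@le_trans _ _ (P ([set w | (l w <= 2 * tau)%R] `|`
      ([set w | (2 * tau < l w)%R] `&` [set w | (D' k w < tau)%R])))%E).
    apply: le_measure; rewrite ?inE.
    - by apply: measurableC; exact: (mge _ _ (mD' k)).
    - by apply: measurableU; [exact: measurable_le_fun | exact: mEk].
    - move=> w /= /negP; rewrite -ltNge => D'w.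
      by have [tl|tl] := ltP (2 * tau) (l w); [right | left].
  apply: le_trans (measureU2 _ _ _) _; first exact: measurable_le_fun.
    exact: mEk.
  have -> : ((2 * e3)%:E = e3%:E + e3%:E)%E by rewrite -EFinD; congr EFin; ring.
  exact: leeD.
apply: le_trans (auroc_ge (mD k) (mD' k) (ltW tau0)).
have p1 := probability_ge_setC (measurable_le_fun tau (mD k)) h1.
have p2 := probability_ge_setC (mge _ tau (mD' k)) h3.
apply: (@le_trans _ _ ((1 - e3)%:E * (1 - 2 * e3)%:E)%E).
  by rewrite -EFinM lee_fin /e3; nra.
by apply: lee_pmul => //; rewrite lee_fin /e3; lra.
Unshelve. all: by end_near. Qed.

End Probability.

(** * Euclidean distances as random variables, the conditional measure, and the conclusion *)

Lemma cvg_enorm (R : realType) (n : nat) (T : Type) (F : set_system T)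
    {FF : Filter F} (f : T -> 'rV[R]_n) (u : 'rV[R]_n) :
  f x @[x --> F] --> u -> enorm (f x) @[x --> F] --> enorm u.
Proof.
move=> fu; have dfu : dotv (f x) (f x) @[x --> F] --> dotv u u by exact: cvg_dotv.
exact: (cvg_comp _ _ dfu (@sqrt_continuous R _)).
Qed.

Lemma measurable_enormB (R : realType) (n : nat) (d : measure_display)
    (Omega : measurableType d) (X Y : Omega -> 'rV[R]_n) :
  random_vector X -> random_vector Y ->
  measurable_fun setT (fun w => enorm (X w - Y w)).
Proof.
move=> mX mY.
have msqrt : measurable_fun setT (@Num.sqrt R).
  by apply: nondecreasing_measurable => // a b; exact: ler_wsqrtr.
suff mdot : measurable_fun setT (fun w => dotv (X w - Y w) (X w - Y w)).
  exact: (measurableT_comp msqrt mdot).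
apply: measurable_sum => i.
have mXY : measurable_fun setT (fun w => (X w - Y w) ord0 i).
  have -> : (fun w => (X w - Y w) ord0 i) = (fun w => X w ord0 i - Y w ord0 i).
    by apply/funext => w; rewrite !mxE.
  exact: measurable_funB.
exact: measurable_funM.
Qed.

Lemma cond_prob_ae (R : realType) (d : measure_display) (Omega : measurableType d)
    (P : probability Omega R) (S : set Omega) (mS : measurable S) :
  (0 < P S)%E -> {ae cond_prob P mS, forall w, S w}.
Proof.
move=> S0; exists (~` S); split => //; first exact: measurableC.
have PS : mrestr P mS setT = P S by rewrite /mrestr setTI.
(* [mnormalize] falls back to its default measure when the total mass is 0 or infinite; both cases
   are excluded. *)
rewrite /cond_prob /= /mnormalize /= PS gt_eqF //=.
rewrite lt_eqF /=; last by rewrite (le_lt_trans (probability_le1 _ mS)) ?ltry.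
by rewrite /mrestr setICl measure0 mul0e.
Qed.

Theorem theorem5 (R : realType) (n c N : nat)
    (n_ge1 : (1 <= n)%N) (c_ge2 : (2 <= c)%N)
    (Z : 'rV[R]_n -> 'rV[R]_c) (Q : 'I_N -> set 'rV[R]_n)
    (ZQ : relu_logits Z Q)
    (boundary_null : lebesgue_rV (decision_boundary Z) = 0%E)
    (no_boundary_facet : forall i F, facet (Q i) F ->
       ~ F `<=` decision_boundary Z)
    (d : measure_display) (Omega : measurableType d)
    (P0 : probability Omega R)
    (X : Omega -> 'rV[R]_n) (mX : random_vector X)
    (X_cube : forall w, cube (X w)) (X_density : continuous_density P0 X)
    (a : R) (a_gt0 : 0 < a) (alpha : nat -> R) (alpha_adm : admissible alpha)
    (x : nat -> Omega -> 'rV[R]_n)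
    (x_attack : forall w t, kappa Z (X w) = Some t ->
       primary_attack Z t a alpha (X w) (x ^~ w))
    (mS : measurable (success_event Z X x))
    (S_gt0 : (0 < P0 (success_event Z X x))%E)
    (P : probability Omega R) (PE : P = cond_prob P0 mS)
    (Xk : nat -> Omega -> 'rV[R]_n) (mXk : forall k, random_vector (Xk k))
    (Xs : Omega -> 'rV[R]_n) (mXs : random_vector Xs)
    (Xk_iter : {ae P, forall w, forall t, kappa Z (X w) = Some t ->
       feasible_iterates Z t (x ^~ w) (Xk ^~ w)})
    (Xk_cvg : {ae P, forall w, Xk k w @[k --> \oo] --> Xs w})
    (Xs_boundary : {ae P, forall w, forall t, kappa Z (X w) = Some t ->
       feasible_boundary Z t (Xs w)})
    (Xs_stationary : {ae P, forall w, forall t, kappa Z (X w) = Some t ->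
       stationary (objective Z t a (X w)) (Xs w)})
    (Xs_interior : {ae P, forall w, forall i, 0 < Xs w ord0 i < 1})
    (nzg_primary : {ae P, forall w, forall t, kappa Z (X w) = Some t ->
       no_zero_gradients Z Q t})
    (nzg_counter : {ae P, forall w, forall k t2,
       kappa Z (Xk k w) = Some t2 -> no_zero_gradients Z Q t2})
    (Xk_class : {ae P, forall w, forall k, kappa Z (Xk k w) <> None}) :
  exists (B : nat -> Omega -> R) (A : nat -> Omega -> R -> R),
    [/\ forall k w, 0 < B k w,
        forall k w b, 0 < A k w b &
        forall (b : nat -> Omega -> R) (beta : nat -> Omega -> nat -> R)
          (y : nat -> Omega -> nat -> 'rV[R]_n) (jstar : nat -> Omega -> nat),
          {ae P, forall w, forall k,
             [/\ B k w <= b k w, admissible (beta k w) &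
                 beta k w 0%N <= A k w (b k w)]} ->
          {ae P, forall w, forall k t2, kappa Z (Xk k w) = Some t2 ->
             counter_attack Z t2 (b k w) (beta k w) (Xk k w) (y k w)
               (jstar k w)} ->
          (forall k, random_vector (fun w => y k w (jstar k w))) ->
          auroc P (fun w => enorm (Xk k w - y k w (jstar k w)))
                  (fun w => enorm (X w - Xk k w)) @[k --> \oo] --> 1%E].
Proof.
have [A A0 close] := counter_attack_close c_ge2 ZQ.
(* The [harmonic k] term keeps the radius positive even if [Xk k w = Xs w], and still vanishes in
   the limit. *)
pose rho k w := enorm (Xk k w - Xs w) + harmonic k.
have rho0 k w : 0 < rho k w by rewrite ltr_wpDl ?enorm_ge0 ?harmonic_gt0.
(* The threshold 1 makes [b] positive; the step-size threshold absorbs the size of [b]. *)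
exists (fun _ _ => 1), (fun k w => A (rho k w)); split => // [k w b|]; first exact: A0.
move=> b beta y jstar Hb Hca my.
have S_ae : {ae P, forall w, success_event Z X x w} by rewrite PE; exact: cond_prob_ae.
have Xs_cube : {ae P, forall w, cube (Xs w)}.
  by apply: filterS Xs_interior => w int i; have /andP[i0 i1] := int i; rewrite !ltW.
apply: (auroc_cvg1 (l := fun w => enorm (X w - Xs w))) => [k|k||||].
- exact: measurable_enormB.
- exact: measurable_enormB.
- exact: measurable_enormB.
- have Xk_ok : {ae P, forall w, (forall k, cube (Xk k w)) /\
      forall k t2, kappa Z (Xk k w) = Some t2 -> kappa Z (Xs w) <> Some t2}.
    apply: filterS3 (filterI S_ae Xs_cube) Xk_iter Xs_boundary => w [[t kt _] cs] iter bd.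
    have [phi [_ feas XkE]] := iter t kt.
    have Xkf k : feasible Z t (Xk k w) by rewrite XkE; apply/feas; exists k.
    split=> [k|k t2 kt2]; first by have [] := Xkf k.
    apply: (kappa_closure_infeasible ZQ cs (bd t kt).2) => t2t.
    by have [_] := Xkf k; rewrite kt2 t2t.
  apply: filterS3 (filterI Xk_ok Xk_class) (filterI Xk_cvg Xs_cube) (filterI Hb Hca)
    => w [[Xkc Xks] Xkn] [cvgw cs] [bw caw].
  have [e e0 pe] := conic_at_exists ZQ cs.
  have rhol : rho k w @[k --> \oo] --> 0.
    rewrite -[X in _ --> X]addr0 -[X in _ --> X + _](@enorm0 R n) -(subrr (Xs w)).
    apply: cvgD; last exact: cvg_harmonic.
    by apply: cvg_enorm; apply: cvgB => //; exact: cvg_cst.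
  have e4 : 0 < e / 4 by rewrite divr_gt0.
  (* The radius [e] depends on the realization but not on [k], so [4 * rho k w < e] holds for all
     large [k]. *)
  have dist : \forall k \near \oo, 0 <= enorm (Xk k w - y k w (jstar k w)) <= 5 * rho k w.
    apply: filterS (cvgr_lt _ rhol _ e4) => k rhok; rewrite enorm_ge0 /=.
    case kE : (kappa Z (Xk k w)) (Xkn k) => [t2|//] _.
    have [b1 adm bA] := bw k.
    apply: (close (Xs w) e _ t2 _ (b k w) (beta k w)) => //.
    + exact: Xks kE.
    + by rewrite lerDl harmonic_ge0.
    + by move: rhok; rewrite ltr_pdivlMr // mulrC.
    + exact: lt_le_trans b1.
    + exact: caw.
  have rhol5 : 5 * rho k w @[k --> \oo] --> (5 * 0 : R).
    by apply: cvgM => //; exact: cvg_cst.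
  rewrite mulr0 in rhol5.
  by apply: (squeeze_cvgr dist) => //; exact: cvg_cst.
- by apply: filterS Xk_cvg => w Xw; apply: cvg_enorm; apply: cvgB => //; exact: cvg_cst.
(* [X w] has class [t], while [Xs w], a limit of feasible points, does not; hence they differ. *)
- apply: filterS3 S_ae Xs_cube Xs_boundary => w [t kt _] cs bd.
  rewrite lt0r enorm_ge0 andbT; apply/eqP => /enorm_eq0 /subr0_eq XE.
  by apply: (kappa_closure_feasible ZQ cs (bd t kt).1); rewrite -XE.
Qed.
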